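(* Let $n\ge2$, $m\ge1$, $q=2^m$, and let $\mathbf{H}_X^{(q)}$, $\mathbf{H}_Z^{(q)}$ be $q$-ary labelings of the toric Tanner graphs $\mathcal{G}_X$, $\mathcal{G}_Z$ (as in the context) with codes $\mathcal{C}_X^{(q)}$, $\mathcal{C}_Z^{(q)}$, such that every cycle of the labeled graph $\mathcal{G}_X$ has product $1$ and $(\mathcal{C}_Z^{(q)})^\perp\subset\mathcal{C}_X^{(q)}$. Then the extended toric code $(\hat{\mathcal{C}}_X,\hat{\mathcal{C}}_Z)$ has quantum dimension $2m$, i.e. $\dim\hat{\mathcal{C}}_X-\dim\hat{\mathcal{C}}_Z^\perp=2m$.
   Context: Indices are taken in $\mathbb{Z}_{2n}=\{0,\dots,2n-1\}$ with arithmetic mod $2n$. Variable nodes: $V=\{(i,j)\in\mathbb{Z}_{2n}^2: i+j\text{ even}\}$ ($2n^2$ nodes). $X$-checks: $C_X=\{(i,j): i\text{ odd}, j\text{ even}\}$; $Z$-checks: $C_Z=\{(i,j): i\text{ even}, j\text{ odd}\}$. Each check $(i,j)$ is adjacent to the variable nodes $(i\pm1,j)$, $(i,j\pm1)$; $\mathcal{G}_X$, $\mathcal{G}_Z$ are the bipartite graphs on $V\cup C_X$, $V\cup C_Z$. A $q$-ary labeling is $\mathbf{H}_X^{(q)}=(x_{c,v})\in\mathbb{F}_q^{C_X\times V}$ with $x_{c,v}\ne0$ iff $c,v$ adjacent, similarly $\mathbf{H}_Z^{(q)}\in\mathbb{F}_q^{C_Z\times V}$; $\mathcal{C}_X^{(q)}=\ker\mathbf{H}_X^{(q)}$,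 $\mathcal{C}_Z^{(q)}=\ker\mathbf{H}_Z^{(q)}$, $\perp$ w.r.t. the standard bilinear form. For a cycle $v_1,c_1,\dots,v_k,c_k,v_1$ of labeled $\mathcal{G}_X$ its product is $\prod_t x_{c_t v_{t+1}}x_{c_t v_t}^{-1}$. Extended toric code: fix an $\mathbb{F}_2$-basis of $\mathbb{F}_{2^m}$ and let $A:\mathbb{F}_{2^m}\to\mathbb{F}_2^{m\times m}$ send $a$ to the matrix of multiplication by $a$ in that basis (an injective ring homomorphism). $\hat{\mathbf{H}}_X$ is the binary matrix obtained from $\mathbf{H}_X^{(q)}$ by replacing each entry $h$ by the $m\times m$ block $A(h)$, and $\hat{\mathbf{H}}_Z$ is obtained from $\mathbf{H}_Z^{(q)}$ by replacing each entry $h$ by $A(h)^T$ (zero entries become zero blocks); then $\hat{\mathbf{H}}_X\hat{\mathbf{H}}_Z^T=0$. $\hat{\mathcal{C}}_X=\ker\hat{\mathbf{H}}_X$, $\hat{\mathcal{C}}_Z=\ker\hat{\mathbf{H}}_Z\subset\mathbb{F}_2^{2mn^2}$, with $\perp$ the standard binary dual; the quantum dimension of the CSS code $(\hat{\mathcal{C}}_X,\hat{\mathcal{C}}_Z)$ is $\dim\hat{\mathcal{C}}_X-\dim\hat{\mathcal{C}}_Z^\perp$. *)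

(* Defs.v *)
From HB Require Import structures.
From mathcomp Require Import all_boot all_order all_algebra.
Set Implicit Arguments. Unset Strict Implicit. Unset Printing Implicit Defensive.
Import GRing.Theory.
Local Open Scope ring_scope.

(* Grid coordinates in Z_{2n} are represented by 'I_(2n); arithmetic mod 2n. *)
Definition sucN (N : nat) (k : nat) : nat := (k.+1 %% N)%N.

Definition Vt (n : nat) := {x : 'I_(2 * n) * 'I_(2 * n) | ~~ odd (x.1 + x.2)}.
Definition CXt (n : nat) := {x : 'I_(2 * n) * 'I_(2 * n) | odd x.1 && ~~ odd x.2}.
Definition CZt (n : nat) := {x : 'I_(2 * n) * 'I_(2 * n) | ~~ odd x.1 && odd x.2}.

Definition grid_adj (n : nat) (c v : 'I_(2 * n) * 'I_(2 * n)) : bool :=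
  ((val v.2 == val c.2) &&
     ((val v.1 == sucN (2 * n) c.1) || (val c.1 == sucN (2 * n) v.1)))
  || ((val v.1 == val c.1) &&
     ((val v.2 == sucN (2 * n) c.2) || (val c.2 == sucN (2 * n) v.2))).

Definition entry (R : Type) (C V : finType) (H : 'M[R]_(#|{: C}|, #|{: V}|)) (c : C) (v : V) : R :=
  H (enum_rank c) (enum_rank v).

Definition is_labeling (F : fieldType) (n : nat) (C : finType)
    (pos : C -> 'I_(2 * n) * 'I_(2 * n)) (H : 'M[F]_(#|{: C}|, #|{: Vt n}|)) : Prop :=
  forall (c : C) (v : Vt n), (entry H c v != 0) = grid_adj (pos c) (val v).

(* Every (simple) cycle v_1,c_1,...,v_k,c_k,v_1 of the labeled graph G_X
   has product prod_t x_{c_t v_{t+1}} x_{c_t v_t}^{-1} equal to 1. *)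
Definition cycles_product_one (F : fieldType) (n : nat)
    (H : 'M[F]_(#|{: CXt n}|, #|{: Vt n}|)) : Prop :=
  forall (k : nat) (vs : 'I_k -> Vt n) (cs : 'I_k -> CXt n),
    (2 <= k)%N -> injective vs -> injective cs ->
    (forall t : 'I_k, grid_adj (val (cs t)) (val (vs t))
                      && grid_adj (val (cs t)) (val (vs (ordS t)))) ->
    \prod_(t < k) (entry H (cs t) (vs (ordS t)) / entry H (cs t) (vs t)) = 1.

(* Codes as row spaces: the kernel {u | H u = 0} and the dual S^perp
   (standard bilinear form); dimension = rank. *)
Definition code_ker (R : fieldType) (p q : nat) (H : 'M[R]_(p, q)) : 'M[R]_q :=
  kermx H^T.
Definition code_dual (R : fieldType) (p q : nat) (S : 'M[R]_(p, q)) : 'M[R]_q :=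
  kermx S^T.

(* F_2-basis b of F: every element has a unique representation as an
   F_2-linear combination (i.e. a subset sum) of the b_i. *)
Definition is_F2_basis (F : fieldType) (m : nat) (b : 'I_m -> F) : Prop :=
  forall a : F, exists! c : {ffun 'I_m -> bool}, a = \sum_(i | c i) b i.

Definition coordF2 (F : finFieldType) (m : nat) (b : 'I_m -> F) (a : F)
    : {ffun 'I_m -> bool} :=
  odflt [ffun => false] [pick c : {ffun 'I_m -> bool} | a == \sum_(i | c i) b i].

Definition mulmatF2 (F : finFieldType) (m : nat) (b : 'I_m -> F) (a : F) : 'M['F_2]_m :=
  \matrix_(i, j) ((coordF2 b (a * b j) i : nat)%:R).

Definition blowup (F : Type) (m p q : nat) (f : F -> 'M['F_2]_m) (H : 'M[F]_(p, q))
    : 'M['F_2]_(\sum_(i < p) m, \sum_(j < q) m) :=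
  \mxblock_(i < p, j < q) f (H i j).

(* Main.v *)
(* Row reduction commutes with the blow-up, so each binary rank is m times the rank over F_q, and it
   suffices to show that H_X and H_Z both have corank 1 in their rows. Every variable has exactly two
   neighbours of each check type, and the checks of one type are connected through variables, so a
   left kernel vector is determined by one coordinate. For H_X a nowhere zero kernel vector Y is a
   potential of the edge ratios on the n x n torus of X-checks: orthogonality with H_Z makes the
   faces consistent, the cycle hypothesis the two noncontractible directions. Then Y_c x_{c,v} = w_v
   does not depend on the check c, orthogonality makes w_v z_{d,v} independent of v, and the inverses
   of these numbers form a kernel vector for H_Z; both cancellations use characteristic 2. *)
Require Import Defs.
From HB Require Import structures.
From mathcomp Require Import all_boot all_order all_algebra all_field.
From mathcomp Require Import ring zify.
Set Implicit Arguments. Unset Strict Implicit. Unset Printing Implicit Defensive.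
Import GRing.Theory.
Local Open Scope ring_scope.

(** * Ranks of binary expansions *)

Section Blowup.

Variables (F : fieldType) (m : nat) (f : F -> 'M['F_2]_m).
Hypotheses (fD : {morph f : x y / x + y}) (fM : {morph f : x y / x * y >-> x *m y}).
Hypothesis f1 : f 1 = 1%:M.

Lemma blowup_morph0 : f 0 = 0.
Proof. by apply: (@addIr _ (f 0)); rewrite -fD !add0r. Qed.

Lemma blowupM p q r (A : 'M[F]_(p, q)) (B : 'M[F]_(q, r)) :
  blowup f (A *m B) = blowup f A *m blowup f B.
Proof.
rewrite /blowup mul_mxblock; apply: eq_mxblock => i k; rewrite mxE.
rewrite (big_morph f fD blowup_morph0).
by apply: eq_bigr => j _; rewrite fM.
Qed.

Lemma blowup1 p : blowup f (1%:M : 'M_p) = 1%:M.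
Proof.
rewrite -mxdiagZ; apply: eq_mxblock => i j; rewrite mxE.
by case: (i == j); rewrite ?conform_mx_id ?f1 ?blowup_morph0.
Qed.

(** The bound from above comes from the factorization of [H] through dimension [r], whose blow-up
    passes through dimension [r * m]. The bound from below comes from [L *m H *m R = 1%:M] of size
    [r], whose blow-up is an identity of rank [r * m]. *)
Lemma rank_blowup p q (H : 'M[F]_(p, q)) :
  \rank (blowup f H) = (\rank H * m)%N.
Proof.
set r := \rank H.
have dimE : (\sum_(i < r) m = r * m)%N by rewrite sum_nat_const card_ord.
apply/anti_leq/andP; split.
  rewrite -(mulmx_base H) blowupM (leq_trans (mxrankM_maxr _ _)) //.
  by rewrite -/r -dimE rank_leq_row.
have : \rank (blowup f (1%:M : 'M[F]_r)) = (r * m)%N.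
  by rewrite blowup1 mxrank1.
have /row_freeP [R HR] := row_base_free H.
have /row_fullP [L HL] := col_base_full H.
have -> : 1%:M = L *m H *m R :> 'M_r.
  have <- : L *m (col_base H *m row_base H) *m R = 1%:M.
    by rewrite mulmxA HL mul1mx HR.
  by rewrite mulmx_base.
rewrite !blowupM => <-.
exact: leq_trans (mxrankM_maxl _ _) (mxrankM_maxr _ _).
Qed.

End Blowup.

(** * Multiplication matrices over the prime field *)

Section MulMatrix.

Variables (F : finFieldType) (m : nat) (b : 'I_m -> F).
Hypotheses (basis_b : is_F2_basis b) (pchar2 : 2%N \in [pchar F]).

Definition F2comb (c : 'I_m -> 'F_2) : F := \sum_i (c i : nat)%:R * b i.

Lemma F2D (x y : 'F_2) : (((x + y)%R : 'F_2) : nat)%:R = (x : nat)%:R + (y : nat)%:R :> F.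
Proof.
case: x y => [[|[|//]] /= ?] [[|[|//]] /= ?]; rewrite ?addr0 ?add0r //.
(* Only [1 + 1] remains: it is [0] in ['F_2], so [2 = 0] is required in [F]. *)
exact: (esym (pcharf0 pchar2)).
Qed.

Lemma F2M (x y : 'F_2) : (((x * y)%R : 'F_2) : nat)%:R = (x : nat)%:R * (y : nat)%:R :> F.
Proof.
by case: x y => [[|[|//]] /= ?] [[|[|//]] /= ?]; rewrite /= ?mulr0 ?mul0r ?mulr1.
Qed.

(** Reading an ['F_2] coefficient as the boolean of being nonzero turns combinations into subset
    sums, where the basis hypothesis gives uniqueness. *)
Lemma F2comb_inj c d : F2comb c = F2comb d -> c =1 d.
Proof.
pose toB (e : 'I_m -> 'F_2) := [ffun i => e i != 0].
have combE e : F2comb e = \sum_(i | toB e i) b i.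
  rewrite [RHS]big_mkcond; apply: eq_bigr => i _; rewrite ffunE.
  by case: (e i) => [[|[|//]] /= ?]; rewrite /= ?mul0r ?mul1r.
move=> cd i; have [e [_ uniq_e]] := basis_b (F2comb c).
have: toB c = toB d.
  by rewrite -(uniq_e _ (combE c)); apply: uniq_e; rewrite cd; apply: combE.
move/ffunP/(_ i); rewrite !ffunE.
by case: (c i) (d i) => [[|[|//]] /= ?] [[|[|//]] /= ?] //= _; apply: val_inj.
Qed.

Lemma mulmatF2_comb a j : F2comb (mulmatF2 b a ^~ j) = a * b j.
Proof.
rewrite /F2comb; set c := coordF2 b (a * b j).
have -> : a * b j = \sum_(i | c i) b i.
  rewrite /c /coordF2; case: pickP => [d /eqP //|no].
  by have [d [/eqP ad _]] := basis_b (a * b j); have := no d; rewrite ad.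
rewrite [RHS]big_mkcond; apply: eq_bigr => i _; rewrite mxE -/c.
by case: (c i); rewrite ?mul0r ?mul1r.
Qed.

(** Reduces each ring law for [mulmatF2] to an identity in [F] tested on the basis elements, one
    column at a time. *)
Lemma mulmatF2_eq a (M : 'M_m) :
  (forall j, F2comb (M ^~ j) = a * b j) -> mulmatF2 b a = M.
Proof.
move=> HM; apply/matrixP => i j; apply: (@F2comb_inj (mulmatF2 b a ^~ j) (M ^~ j)).
by rewrite mulmatF2_comb HM.
Qed.

Lemma mulmatF2D : {morph mulmatF2 b : x y / x + y}.
Proof.
move=> x y; apply: mulmatF2_eq => j; rewrite mulrDl -!mulmatF2_comb -big_split.
by apply: eq_bigr => i _; rewrite mxE F2D mulrDl.
Qed.

Lemma F2_sum (I : finType) (g : I -> 'F_2) :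
  (((\sum_i g i)%R : 'F_2) : nat)%:R = \sum_i (g i : nat)%:R :> F.
Proof. exact: (big_morph (fun x : 'F_2 => (x : nat)%:R) F2D). Qed.

Lemma mulmatF2M : {morph mulmatF2 b : x y / x * y >-> x *m y}.
Proof.
move=> x y; apply: mulmatF2_eq => j.
rewrite -mulrA -[y * b j]mulmatF2_comb /F2comb mulr_sumr.
(* Both sides become double sums: [y * b j] is expanded in the basis, and then each [x * b k]. *)
under [RHS]eq_bigr => k _ do rewrite mulrCA -mulmatF2_comb mulr_sumr.
rewrite exchange_big; apply: eq_bigr => i _ /=.
rewrite mxE F2_sum mulr_suml; apply: eq_bigr => k _.
by rewrite F2M; ring.
Qed.

Lemma mulmatF2_1 : mulmatF2 b 1 = 1%:M.
Proof.
apply: mulmatF2_eq => j; rewrite /F2comb (bigD1 j) //= big1 ?addr0 => [|i ij].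
  by rewrite mxE eqxx.
by rewrite mxE (negPf ij) mul0r.
Qed.

Lemma rank_blowup_mulmatF2 p q (H : 'M[F]_(p, q)) :
  \rank (blowup (mulmatF2 b) H) = (\rank H * m)%N.
Proof. exact: rank_blowup mulmatF2D mulmatF2M mulmatF2_1 _ _ _. Qed.

(** Transposition reverses products, but commutativity of [F] keeps the transposed map
    multiplicative. *)
Lemma rank_blowup_tr_mulmatF2 p q (H : 'M[F]_(p, q)) :
  \rank (blowup (fun h => (mulmatF2 b h)^T) H) = (\rank H * m)%N.
Proof.
apply: rank_blowup => [x y|x y|]; first by rewrite mulmatF2D linearD.
  by rewrite -trmx_mul -mulmatF2M mulrC.
by rewrite mulmatF2_1 trmx1.
Qed.

End MulMatrix.

(** * Kernel codes and double duals *)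

Lemma rank_code_ker (K : fieldType) p q (H : 'M[K]_(p, q)) :
  \rank (code_ker H) = (q - \rank H)%N.
Proof. by rewrite /code_ker mxrank_ker mxrank_tr. Qed.

(** The rows of [H] are orthogonal to its kernel, and both spaces have rank [\rank H]. *)
Lemma code_dual_ker (K : fieldType) p q (H : 'M[K]_(p, q)) :
  (code_dual (code_ker H) :=: H)%MS.
Proof.
apply/eqmxP; rewrite andbC -mxrank_leqif_eq.
  rewrite /code_dual /code_ker mxrank_ker mxrank_tr mxrank_ker mxrank_tr.
  by rewrite subKn // rank_leq_col.
by apply/sub_kermxP; rewrite -[LHS]trmxK trmx_mul trmxK mulmx_ker trmx0.
Qed.

(** * Potentials on a periodic grid *)

Section GridPotential.

Variables (F : fieldType) (n : nat) (V H : nat -> nat -> F).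
Hypotheses (V_neq0 : forall a b, V a b != 0) (H_neq0 : forall a b, H a b != 0).
Hypothesis face : forall a b, V a b * H a.+1 b = H a b * V a b.+1.
Hypothesis (V_per : forall a b, V (a + n) b = V a b).
Hypothesis (H_perl : forall a b, H (a + n) b = H a b).
Hypothesis (H_perr : forall a b, H a (b + n) = H a b).
Hypothesis (V_cycle : \prod_(a < n) V a 0%N = 1).
Hypothesis (H_cycle : forall a, \prod_(b < n) H a b = 1).

(** The product of edge ratios along one fixed path from the origin: first along the axis of second
    coordinate [0], then in the second direction. *)
Definition grid_potential a b := \prod_(i < a) V i 0%N * \prod_(j < b) H a j.

Lemma grid_potential_neq0 a b : grid_potential a b != 0.
Proof. by rewrite mulf_neq0 //; apply/prodf_neq0 => i _. Qed.

Lemma grid_potential_stepr a b :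
  grid_potential a b.+1 = grid_potential a b * H a b.
Proof. by rewrite /grid_potential big_ord_recr mulrA. Qed.

(** On the axis this is the definition; each unit away from the axis moves the step across one face
    by [face]. *)
Lemma grid_potential_stepl a b :
  grid_potential a.+1 b = grid_potential a b * V a b.
Proof.
elim: b => [|b IHb]; first by rewrite /grid_potential big_ord_recr !big_ord0 !mulr1.
by rewrite !grid_potential_stepr IHb -!mulrA face.
Qed.

Lemma prod_periodic (f : nat -> F) a :
    (forall i, f (i + n)%N = f i) -> \prod_(i < n) f i = 1 ->
  \prod_(i < a + n) f i = \prod_(i < a) f i.
Proof.
move=> fper f1; rewrite addnC big_split_ord /= f1 mul1r.
by apply: eq_bigr => i _; rewrite addnC fper.
Qed.

Lemma grid_potential_perl a b :
  grid_potential (a + n) b = grid_potential a b.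
Proof.
rewrite /grid_potential (@prod_periodic (V ^~ 0%N)) //.
by congr (_ * _); apply: eq_bigr => j _.
Qed.

Lemma grid_potential_perr a b :
  grid_potential a (b + n) = grid_potential a b.
Proof. by rewrite /grid_potential prod_periodic. Qed.

End GridPotential.

Lemma periodic_modn (A : Type) n (f : nat -> A) k :
  (forall i, f (i + n)%N = f i) -> f (k %% n)%N = f k.
Proof.
move=> fper; rewrite {2}(divn_eq k n) addnC.
by elim: (k %/ n)%N => [|q IHq]; rewrite ?addn0 // mulSn addnCA addnC fper.
Qed.

Lemma odd_mod_double k n : odd (k %% (2 * n)) = odd k.
Proof. by rewrite {2}(divn_eq k (2 * n)) oddD !oddM /= andbF. Qed.

Lemma prod_shift (F : fieldType) n (f : nat -> F) :
  f n = f 0%N -> \prod_(i < n) f i.+1 = \prod_(i < n) f i.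
Proof.
case: n => [|n] fn; first by rewrite !big_ord0.
by rewrite big_ord_recr big_ord_recl /= fn mulrC.
Qed.

(** * The toric grid *)

Section Grid.

Variable n : nat.
Hypothesis n_gt1 : (2 <= n)%N.
Local Notation T := 'I_(2 * n).
Local Notation pos := (T * T)%type.

Definition near (i j : T) := (j == ordS i) || (i == ordS j).
(* [s = true] gives the X-checks, [s = false] the Z-checks. *)
Definition check_pos (s : bool) (c : pos) := (odd c.1 == s) && (odd c.2 == ~~ s).

Lemma check_posE s i j : check_pos s (i, j) = (odd i == s) && (odd j == ~~ s).
Proof. by []. Qed.

Definition var_pos (v : pos) := ~~ odd (v.1 + v.2).

Lemma grid_adjE (c v : pos) :
  grid_adj c v = (v.2 == c.2) && near c.1 v.1 || (v.1 == c.1) && near c.2 v.2.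
Proof. by []. Qed.

Lemma nearC i j : near i j = near j i.
Proof. by rewrite /near orbC. Qed.

Lemma nearS i : near i (ordS i).
Proof. by rewrite /near eqxx. Qed.

Lemma odd_ordS (i : T) : odd (ordS i) = ~~ odd i.
Proof. by rewrite /= odd_mod_double. Qed.

Lemma near_odd i j : near i j -> odd j = ~~ odd i.
Proof. by case/orP=> /eqP ->; rewrite odd_ordS ?negbK. Qed.

Lemma near_neq i j : near i j -> j != i.
Proof. by move/near_odd => ij; apply: contra_eqN ij => /eqP ->; case: (odd i). Qed.

(** Here [2 <= n] enters: 2 is nonzero modulo [2 * n], so the two checks on either side of a
    variable are distinct. *)
Lemma ordSS_neq (i : T) : ordS (ordS i) != i.
Proof.
rewrite -val_eqE /= -addn1 modnDml -[X in _ != X](modn_small (ltn_ord i)).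
rewrite addn1 -addn2 -[X in _ != X %[mod _]]addn0 eqn_modDl.
by rewrite !modn_small //; lia.
Qed.

Lemma check_adj_var s c v : check_pos s c -> grid_adj c v -> var_pos v.
Proof.
case: c v => [i j] [k l] /andP[/= /eqP oi /eqP oj]; rewrite grid_adjE /var_pos /=.
by rewrite oddD => /orP[] /andP[/eqP-> /near_odd->]; rewrite oi oj; case: (s).
Qed.

(** The four neighbours of the variable split by parity: those in the other direction are checks of
    the opposite type. *)
Lemma check_above s i j c :
    check_pos s (i, j) -> check_pos s c -> grid_adj c (ordS i, j) ->
  c = (i, j) \/ c = (ordS (ordS i), j).
Proof.
case: c => k l /andP[/= /eqP oi /eqP oj] /andP[/= /eqP ok /eqP ol].
rewrite grid_adjE /=.
case/orP=> [/andP[/eqP <- /orP[/eqP/ordS_inj->|/eqP->]]|]; [by left|by right|].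
by case/andP=> /eqP e; move: (odd_ordS i); rewrite e ok oi; case: (s).
Qed.

Lemma check_right s i j c :
    check_pos s (i, j) -> check_pos s c -> grid_adj c (i, ordS j) ->
  c = (i, j) \/ c = (i, ordS (ordS j)).
Proof.
case: c => k l /andP[/= /eqP oi /eqP oj] /andP[/= /eqP ok /eqP ol].
rewrite grid_adjE /= orbC.
case/orP=> [/andP[/eqP <- /orP[/eqP/ordS_inj->|/eqP->]]|]; [by left|by right|].
by case/andP=> /eqP e; move: (odd_ordS j); rewrite e ol oj; case: (s).
Qed.

Lemma check_SSl s i j : check_pos s (i, j) -> check_pos s (ordS (ordS i), j).
Proof. by rewrite !check_posE !odd_ordS negbK. Qed.

Lemma check_SSr s i j : check_pos s (i, j) -> check_pos s (i, ordS (ordS j)).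
Proof. by rewrite !check_posE !odd_ordS negbK. Qed.

Lemma adj_vert i i' j : near i i' -> grid_adj (i, j) (i', j).
Proof. by rewrite grid_adjE /= eqxx => ->. Qed.

Lemma adj_horiz i j j' : near j j' -> grid_adj (i, j) (i, j').
Proof. by rewrite grid_adjE /= eqxx => ->; rewrite orbT. Qed.

(** The parity of the first coordinate decides in which direction the neighbours of type [s] lie;
    the witness is the predecessor in that direction. *)
Lemma varP s v : var_pos v ->
  exists i j, check_pos s (i, j) /\ (v = (ordS i, j) \/ v = (i, ordS j)).
Proof.
case: v => i j; rewrite /var_pos /= oddD => oij.
have odd_pred (k : T) : odd (ord_pred k) = ~~ odd k.
  by rewrite -[in RHS](ord_predK k) odd_ordS negbK.
have [oi|oi] := boolP (odd i == s).
  exists i, (ord_pred j); rewrite ord_predK; split; last by right.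
  by rewrite check_posE odd_pred; case: (odd i) (odd j) (s) oi oij => [] [] [].
exists (ord_pred i), j; rewrite ord_predK; split; last by left.
by rewrite check_posE odd_pred; case: (odd i) (odd j) (s) oi oij => [] [] [].
Qed.

(** Checks at opposite corners of a unit square can share only the other two corners, so their
    orthogonality relation has two terms. *)
Lemma corner_adj i i' j j' q : near i i' -> near j j' ->
  grid_adj (i, j) q -> grid_adj (i', j') q -> q = (i', j) \/ q = (i, j').
Proof.
move=> ii jj; case: q => k l; rewrite !grid_adjE /=.
move=> /orP[] /andP[/eqP-> _] /orP[] /andP[/eqP e _]; subst; auto.
  by have := near_neq jj; rewrite eqxx.
by have := near_neq ii; rewrite eqxx.
Qed.

End Grid.

(** * Row kernels of labelings *)

Section Label.

Variables (F : fieldType) (n : nat) (s : bool).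
Hypothesis n_gt1 : (2 <= n)%N.
Local Notation T := 'I_(2 * n).
Local Notation pos := (T * T)%type.
Variable h : pos -> pos -> F.
Hypothesis h_neq0 : forall c v, (h c v != 0) = check_pos s c && grid_adj c v.

Lemma label_sum2 (g : pos -> F) c c' v :
    c != c' ->
    (forall d, check_pos s d -> grid_adj d v -> d = c \/ d = c') ->
  \sum_d g d * h d v = g c * h c v + g c' * h c' v.
Proof.
move=> cc' dP; rewrite (bigD1 c) //= (bigD1 c') 1?eq_sym //=.
rewrite big1 ?addr0 // => d /andP[dc dc']; apply/eqP; rewrite mulf_eq0.
apply/orP; right; apply: contraTT dc'; rewrite h_neq0 => /andP[/dP H /H].
by move: dc => /[swap] -[->|->]; rewrite eqxx.
Qed.

Lemma label_sum_above g i j : check_pos s (i, j) ->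
  \sum_d g d * h d (ordS i, j) =
  g (i, j) * h (i, j) (ordS i, j)
  + g (ordS (ordS i), j) * h (ordS (ordS i), j) (ordS i, j).
Proof.
move=> cij; apply: label_sum2 => [|d]; last exact: check_above.
by rewrite xpair_eqE eq_sym (negPf (ordSS_neq n_gt1 i)).
Qed.

Lemma label_sum_right g i j : check_pos s (i, j) ->
  \sum_d g d * h d (i, ordS j) =
  g (i, j) * h (i, j) (i, ordS j)
  + g (i, ordS (ordS j)) * h (i, ordS (ordS j)) (i, ordS j).
Proof.
move=> cij; apply: label_sum2 => [|d]; last exact: check_right.
by rewrite xpair_eqE eqxx eq_sym (negPf (ordSS_neq n_gt1 j)).
Qed.

Lemma label_above_neq0 i j : check_pos s (i, j) ->
  h (i, j) (ordS i, j) != 0 /\ h (ordS (ordS i), j) (ordS i, j) != 0.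
Proof.
by move=> cij; rewrite !h_neq0 cij check_SSl // !adj_vert // 1?(nearC (ordS (ordS _))) nearS.
Qed.

Lemma label_right_neq0 i j : check_pos s (i, j) ->
  h (i, j) (i, ordS j) != 0 /\ h (i, ordS (ordS j)) (i, ordS j) != 0.
Proof.
by move=> cij; rewrite !h_neq0 cij check_SSr // !adj_horiz // 1?(nearC (ordS (ordS _))) nearS.
Qed.

(** The two checks of type [s] at [v] contribute [w v] each, and [w v + w v = 0] in characteristic
    2. *)
Lemma label_balanced (g w : pos -> F) v : 2%N \in [pchar F] ->
    (forall c, check_pos s c -> grid_adj c v -> g c * h c v = w v) ->
  var_pos v -> \sum_c g c * h c v = 0.
Proof.
move=> pchar2 gw /(varP s)[i [j [cij [vE|vE]]]]; subst v.
  have [h1 h2] := label_above_neq0 cij; move: h1 h2; rewrite !h_neq0.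
  move=> /andP[c1 a1] /andP[c2 a2].
  by rewrite label_sum_above // !gw // -mulr2n -mulr_natr pcharf0 ?mulr0.
have [h1 h2] := label_right_neq0 cij; move: h1 h2; rewrite !h_neq0.
move=> /andP[c1 a1] /andP[c2 a2].
by rewrite label_sum_right // !gw // -mulr2n -mulr_natr pcharf0 ?mulr0.
Qed.

Lemma ordS_reach (P : T -> Prop) (i i' : T) :
  P i -> (forall k : T, odd k = odd i -> P k -> P (ordS (ordS k))) ->
  odd i' = odd i -> P i'.
Proof.
move=> Pi PSS oi.
(* Half the forward distance from [i] to [i']; adding [2 * n] avoids truncated subtraction, and
   equal parities make the distance even. *)
pose d := ((i' + 2 * n - i)./2)%N.
have lti := ltn_ord i; have lti' := ltn_ord i'.
have dE : (i + d.*2 = i' + 2 * n)%N.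
  have le_i : (i <= i' + 2 * n)%N by lia.
  have : ~~ odd (i' + 2 * n - i) by rewrite (oddB le_i) oddD oddM oi addbF addbb.
  by rewrite /d => /even_halfK ->; lia.
have valE k : nat_of_ord (iter k (@ordS _) i) = ((i + k) %% (2 * n))%N.
  elim: k => [|k IHk]; first by rewrite addn0 modn_small.
  by rewrite iterS /= IHk -addn1 modnDml addn1 addnS.
suff -> : i' = iter d.*2 (@ordS _) i.
  elim: d {dE} => [|d IHd] //; rewrite doubleS !iterS; apply: PSS IHd.
  by rewrite valE odd_mod_double oddD odd_double addbF.
by apply: val_inj; rewrite /= valE dE modnDr modn_small.
Qed.

(** At a variable the kernel equation has two terms with nonzero coefficients, so a zero at one
    check forces a zero at the other. *)
Lemma label_kernel_rigid (g : pos -> F) c0 c :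
    (forall v, var_pos v -> \sum_d g d * h d v = 0) ->
    check_pos s c0 -> g c0 = 0 -> check_pos s c -> g c = 0.
Proof.
case: c0 c => i j [i' j'] g0 /[dup] cij /andP[/= /eqP oi /eqP oj] gij.
move=> /andP[/= /eqP oi' /eqP oj'].
have step1 k : check_pos s (k, j) -> g (k, j) = 0 -> g (ordS (ordS k), j) = 0.
  move=> ck gk; have [h1 h2] := label_above_neq0 ck.
  have := g0 (ordS k, j); rewrite label_sum_above // gk mul0r add0r => H.
  apply/eqP; move: (h1); rewrite h_neq0 => /andP[/check_adj_var /[apply] /H /eqP].
  by rewrite mulf_eq0 (negPf h2) orbF.
have step2 k : check_pos s (i', k) -> g (i', k) = 0 -> g (i', ordS (ordS k)) = 0.
  move=> ck gk; have [h1 h2] := label_right_neq0 ck.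
  have := g0 (i', ordS k); rewrite label_sum_right // gk mul0r add0r => H.
  apply/eqP; move: (h1); rewrite h_neq0 => /andP[/check_adj_var /[apply] /H /eqP].
  by rewrite mulf_eq0 (negPf h2) orbF.
(* Zeros travel along the first coordinate to [i'], then along the second to [j']. *)
have gi'j : g (i', j) = 0.
  apply: (ordS_reach (P := fun k => g (k, j) = 0)) gij _ _ => [k ok|].
    by apply: step1; rewrite check_posE ok oi oj !eqxx.
  by rewrite oi oi'.
apply: (ordS_reach (P := fun k => g (i', k) = 0)) gi'j _ _ => [k ok|].
  by apply: step2; rewrite check_posE ok oi' oj !eqxx.
by rewrite oj oj'.
Qed.

End Label.

(** * Rank of a labeling matrix *)

Section LabelMatrix.

Variables (F : fieldType) (n : nat) (s : bool).
Hypothesis n_gt1 : (2 <= n)%N.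
Local Notation T := 'I_(2 * n).
Local Notation pos := (T * T)%type.
Variables (P : pred pos).
Hypothesis PE : P =1 check_pos s.
Variable H : 'M[F]_(#|{: {x | P x}}|, #|{: Vt n}|).

(** Extension by zero to all pairs of positions, so that sums and adjacency arguments avoid subtypes
    and enumeration ranks. *)
Definition label (c v : pos) : F :=
  match insub c : option {x | P x}, insub v : option (Vt n) with
  | Some c', Some v' => entry H c' v' | _, _ => 0
  end.

Lemma labelE (c : {x | P x}) (v : Vt n) : label (val c) (val v) = entry H c v.
Proof. by rewrite /label !valK. Qed.

Lemma label_enum k l : H k l = label (val (enum_val k)) (val (enum_val l)).
Proof. by rewrite labelE /entry !enum_valK. Qed.

Lemma label0r c v : ~~ var_pos v -> label c v = 0.
Proof. by rewrite /label => nv; case: insub => // c'; rewrite insubF //; apply: negPf. Qed.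

Lemma label0l c v : ~~ P c -> label c v = 0.
Proof. by rewrite /label => nc; rewrite insubF //; apply: negPf. Qed.

Hypothesis labH : is_labeling (fun c : {x | P x} => val c) H.

Lemma label_neq0 c v : (label c v != 0) = check_pos s c && grid_adj c v.
Proof.
rewrite -PE; have [Pc|nPc] := boolP (P c); last by rewrite label0l ?eqxx.
have [vv|nvv] := boolP (var_pos v).
  by rewrite (labelE (Sub c Pc) (Sub v vv)) labH.
rewrite label0r // eqxx; apply/esym/negbTE; apply: contra nvv => /=.
by apply: (check_adj_var (s := s)); rewrite -PE.
Qed.

Lemma sum_rows (g : pos -> F) l :
  \sum_k g (val (enum_val k)) * H k l = \sum_c g c * label c (val (enum_val l)).
Proof.
under eq_bigr do rewrite label_enum.
rewrite -(big_enum_val (fun c : {x | P x} => g (val c) * label (val c) _)) /=.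
rewrite -(big_sub P (fun c => g c * label c _)).
rewrite [RHS](bigID P) /= [X in _ + X]big1 ?addr0 //.
by move=> c nPc; rewrite label0l ?mulr0.
Qed.

Lemma sum_cols (g : pos -> F) k :
  \sum_l g (val (enum_val l)) * H k l = \sum_v g v * label (val (enum_val k)) v.
Proof.
under eq_bigr do rewrite label_enum.
rewrite -(big_enum_val (fun v : Vt n => g (val v) * label _ (val v))) /=.
rewrite -(big_sub (@var_pos n) (fun v => g v * label _ v)).
rewrite [RHS](bigID (@var_pos n)) /= [X in _ + X]big1 ?addr0 //.
by move=> c nPc; rewrite label0r ?mulr0.
Qed.

(** The left kernel is the line spanned by [y]: any [u] in it differs from a multiple of [y] by a
    kernel vector vanishing at [c0], which is zero by rigidity. *)
Lemma rank_label (Y : pos -> F) c0 :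
    check_pos s c0 -> Y c0 != 0 ->
    (forall v, var_pos v -> \sum_c Y c * label c v = 0) ->
  \rank H = #|{: {x | P x}}|.-1.
Proof.
move=> cc0 Y0 Ynull.
have Pc0 : P c0 by rewrite PE.
pose k0 := enum_rank (Sub c0 Pc0 : {x | P x}).
have c0E : val (enum_val k0) = c0 by rewrite enum_rankK.
pose y : 'rV[F]_(#|{: {x | P x}}|) := \row_k Y (val (enum_val k)).
have yH : y *m H = 0.
  apply/rowP => l; rewrite !mxE -[RHS](Ynull _ (valP (enum_val l))) -sum_rows.
  by apply: eq_bigr => k _; rewrite mxE.
have rigid (u : 'rV[F]_(#|{: {x | P x}}|)) : u *m H = 0 -> u 0 k0 = 0 -> u = 0.
  move=> uH u0.
  pose g p := if insub p is Some c then u 0 (enum_rank (c : {x | P x})) else 0.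
  have gE k : g (val (enum_val k)) = u 0 k by rewrite /g valK enum_valK.
  apply/rowP => k; rewrite mxE -gE.
  apply: (label_kernel_rigid n_gt1 label_neq0 (c0 := c0)) => //; last first.
  - by rewrite -PE; apply: (valP (enum_val k)).
  - by rewrite -c0E gE.
  move=> v vv; pose l := enum_rank (Sub v vv : Vt n).
  have := congr1 (fun M : 'rV_ _ => M 0 l) uH; rewrite !mxE.
  under eq_bigr do rewrite -gE.
  by rewrite (sum_rows g) enum_rankK.
have ry : \rank y = 1%N.
  rewrite rank_rV; suff -> : y != 0 by [].
  by apply: contraNneq Y0 => /rowP/(_ k0); rewrite !mxE c0E => ->.
have rk : \rank (kermx H) = 1%N.
  apply/anti_leq/andP; split; last by rewrite -[leqLHS]ry mxrankS //; apply/sub_kermxP.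
  rewrite -[leqRHS]ry mxrankS //.
  apply/row_subP => k.
  have: row k (kermx H) *m H = 0 by rewrite -row_mul mulmx_ker row0.
  move: (row k _) => u uH.
  pose a := u 0 k0 / Y c0.
  have -> : u = a *: y.
    apply/eqP; rewrite -subr_eq0; apply/eqP/rigid.
      by rewrite mulmxBl uH -scalemxAl yH scaler0 subr0.
    by rewrite !mxE c0E divfK // subrr.
  exact: scalemx_sub.
by move: rk; rewrite mxrank_ker; have := rank_leq_row H; lia.
Qed.

End LabelMatrix.

(** * Kernel vectors of the orthogonal pair *)

(** The quotients [x / y] are the edge ratios around a face and the [z] are the entries of its
    central Z-check; the four corner relations eliminate the [z]. *)
Lemma face_quotients (F : fieldType) (x1 x2 x3 x4 y1 y2 y3 y4 z1 z2 z3 z4 : F) :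
    y1 != 0 -> y2 != 0 -> y3 != 0 -> y4 != 0 ->
    z1 != 0 -> z2 != 0 -> z4 != 0 ->
    x1 * z1 = x3 * z3 -> y1 * z1 = x2 * z2 ->
    x4 * z4 = y3 * z3 -> y4 * z4 = y2 * z2 ->
  x1 / y1 * (x2 / y2) = x3 / y3 * (x4 / y4).
Proof.
move=> y1n y2n y3n y4n z1n z2n z4n e1 e2 e3 e4.
have -> : x1 = x3 * z3 / z1 by rewrite -e1 mulfK.
have -> : x2 = y1 * z1 / z2 by rewrite e2 mulfK.
have -> : x4 = y3 * z3 / z4 by rewrite -e3 mulfK.
have -> : y4 = y2 * z2 / z4 by rewrite -e4 mulfK.
by field; rewrite y1n y2n y3n z1n z2n z4n.
Qed.

Section ToricPair.

Variables (F : fieldType) (n : nat).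
Hypotheses (n_gt1 : (2 <= n)%N) (pchar2 : 2%N \in [pchar F]).
Local Notation T := 'I_(2 * n).
Local Notation pos := (T * T)%type.
Variables hX hZ : pos -> pos -> F.
Hypothesis hX_neq0 : forall c v, (hX c v != 0) = check_pos true c && grid_adj c v.
Hypothesis hZ_neq0 : forall c v, (hZ c v != 0) = check_pos false c && grid_adj c v.
Hypothesis orthXZ : forall c d, check_pos true c -> check_pos false d ->
  \sum_v hX c v * hZ d v = 0.

Lemma check_corner s (i i' j j' : T) : near i i' -> near j j' ->
  check_pos s (i, j) = check_pos (~~ s) (i', j').
Proof.
move=> /near_odd oi /near_odd oj; rewrite !check_posE oi oj.
by case: (odd i) (odd j) s => [] [] [].
Qed.

(** Orthogonality leaves two terms, at the two shared variables; a zero sum is an equality in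
    characteristic 2. *)
Lemma corner_relation i i' j j' :
    near i i' -> near j j' -> check_pos true (i, j) ->
  hX (i, j) (i', j) * hZ (i', j') (i', j) =
  hX (i, j) (i, j') * hZ (i', j') (i, j').
Proof.
move=> ii jj cij.
have := orthXZ cij; move/(_ (i', j')); rewrite -(check_corner true ii jj).
move/(_ cij); rewrite (bigD1 (i', j)) //= (bigD1 (i, j')) /=; last first.
  by rewrite xpair_eqE eq_sym (negPf (near_neq ii)).
rewrite big1 ?addr0 => [|q /andP[q1 q2]].
  by move/eqP; rewrite addr_eq0 oppr_pchar2 // => /eqP.
apply: contraNeq q2; rewrite mulf_eq0 negb_or hX_neq0 hZ_neq0.
move=> /andP[/andP[_ a1] /andP[_ a2]].
by case: (corner_adj ii jj a1 a2) q1 => ->; rewrite eqxx.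
Qed.

(** The cycle condition for closed lines of length [n.*2], with factors grouped by variable so that
    each is an edge ratio between consecutive checks. *)
Hypothesis line_product : forall L : nat -> pos,
  (forall k, L (k + n.*2)%N = L k) ->
  {in gtn n.*2 &, injective L} ->
  (forall k, check_pos true (L k.*2.+1)) ->
  (forall k, grid_adj (L k.*2.+1) (L k.*2) && grid_adj (L k.*2.+1) (L k.*2.+2)) ->
  \prod_(t < n) (hX (L t.*2.+1) (L t.*2.+2) / hX (L t.*2.+3) (L t.*2.+2)) = 1.

Let n2_gt0 : (0 < 2 * n)%N. Proof. by lia. Qed.
Let o k : T := iter k (@ordS _) (Ordinal n2_gt0).

Let val_o k : nat_of_ord (o k) = (k %% (2 * n))%N.
Proof.
elim: k => [|k IHk]; first by rewrite mod0n.
by rewrite /o iterS -/(o k) /= IHk -addn1 modnDml addn1.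
Qed.

Let oS k : o k.+1 = ordS (o k). Proof. by []. Qed.

Let o_per k : o (k + n.*2) = o k.
Proof. by apply: val_inj; rewrite /= !val_o -mul2n modnDr. Qed.

Let o_val (i : T) : o i = i.
Proof. by apply: val_inj; rewrite /= val_o modn_small. Qed.

Let o_inj : {in gtn n.*2 &, injective o}.
Proof.
move=> k l; rewrite !inE -mul2n => ltk ltl /(congr1 val).
by rewrite /= !val_o !modn_small.
Qed.

Let odd_o k : odd (o k) = odd k.
Proof. by rewrite val_o odd_mod_double. Qed.

(** The X-checks, indexed periodically by natural numbers. The offset [b.*2.+2] puts the checks of a
    line in the second direction at the odd indices of the sequence used in [H_line]. *)
Let c a b : pos := (o a.*2.+1, o b.*2.+2).

Let check_c a b : check_pos true (c a b).
Proof. by rewrite /c check_posE !odd_o /= !odd_double. Qed.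

Let V a b :=
  hX (c a b) (o a.*2.+2, o b.*2.+2) / hX (c a.+1 b) (o a.*2.+2, o b.*2.+2).
Let H a b :=
  hX (c a b) (o a.*2.+1, o b.*2.+3) / hX (c a b.+1) (o a.*2.+1, o b.*2.+3).

Let Vnum a b : hX (c a b) (o a.*2.+2, o b.*2.+2) != 0.
Proof. by have [] := label_above_neq0 hX_neq0 (check_c a b). Qed.
Let Vden a b : hX (c a.+1 b) (o a.*2.+2, o b.*2.+2) != 0.
Proof. by have [] := label_above_neq0 hX_neq0 (check_c a b). Qed.
Let Hnum a b : hX (c a b) (o a.*2.+1, o b.*2.+3) != 0.
Proof. by have [] := label_right_neq0 hX_neq0 (check_c a b). Qed.
Let Hden a b : hX (c a b.+1) (o a.*2.+1, o b.*2.+3) != 0.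
Proof. by have [] := label_right_neq0 hX_neq0 (check_c a b). Qed.

Let face a b : V a b * H a.+1 b = H a b * V a b.+1.
Proof.
(* the Z-check in the middle of the face *)
set d : pos := (o a.*2.+2, o b.*2.+3).
have n1 k : near (o k) (o k.+1) by rewrite oS nearS.
have n2 k : near (o k.+1) (o k) by rewrite nearC.
have r00 := corner_relation (n1 a.*2.+1) (n1 b.*2.+2) (check_c a b).
have r10 := corner_relation (n2 a.*2.+2) (n1 b.*2.+2) (check_c a.+1 b).
have r01 := corner_relation (n1 a.*2.+1) (n2 b.*2.+3) (check_c a b.+1).
have r11 := corner_relation (n2 a.*2.+2) (n2 b.*2.+3) (check_c a.+1 b.+1).
have cd : check_pos false d.
  by rewrite -(check_corner true (n1 a.*2.+1) (n1 b.*2.+2)) check_c.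
have z1 : hZ d (o a.*2.+2, o b.*2.+2) != 0.
  by rewrite hZ_neq0 cd adj_horiz.
have z2 : hZ d (o a.*2.+3, o b.*2.+3) != 0.
  by rewrite hZ_neq0 cd adj_vert.
have z4 : hZ d (o a.*2.+2, o b.*2.+4) != 0.
  by rewrite hZ_neq0 cd adj_horiz.
exact: (face_quotients (Vden a b) (Hden a.+1 b) (Hden a b) (Vden a b.+1)
  z1 z2 z4 r00 r10 r01 r11).
Qed.

Let c_perl a b : c (a + n) b = c a b.
Proof. by rewrite /c doubleD -addSn o_per. Qed.

Let c_perr a b : c a (b + n) = c a b.
Proof. by rewrite /c doubleD -!addSn o_per. Qed.

Let V_per a b : V (a + n) b = V a b.
Proof. by rewrite /V -addSn !c_perl doubleD -!addSn o_per. Qed.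

Let H_perl a b : H (a + n) b = H a b.
Proof. by rewrite /H !c_perl doubleD -addSn o_per. Qed.

Let H_perr a b : H a (b + n) = H a b.
Proof. by rewrite /H -addSn !c_perr doubleD -!addSn o_per. Qed.

Let V_line : \prod_(a < n) V a 0 = 1.
Proof.
apply: (line_product (L := fun k => (o k, o 2))).
- by move=> k; rewrite o_per.
- by move=> k l kn ln [] /o_inj; apply.
- by move=> k; apply: (check_c k 0).
by move=> k; rewrite !adj_vert // oS ?nearS // nearC nearS.
Qed.

Let H_line a : \prod_(b < n) H a b = 1.
Proof.
apply: (line_product (L := fun k => (o a.*2.+1, o k.+1))).
- by move=> k; rewrite -addSn o_per.
- by move=> k l kn ln /(congr1 snd) /ordS_inj /o_inj; apply.
- by move=> k; apply: (check_c a k).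
by move=> k; rewrite !adj_horiz // oS ?nearS // nearC nearS.
Qed.

Let y := grid_potential V H.

(** The path products are periodic in both directions, hence descend to the torus; each step
    multiplies by an edge ratio whose denominator then cancels. *)
Lemma X_potential : exists Y : pos -> F,
  [/\ forall p, check_pos true p -> Y p != 0,
      forall i j, check_pos true (i, j) ->
        Y (i, j) * hX (i, j) (ordS i, j) =
        Y (ordS (ordS i), j) * hX (ordS (ordS i), j) (ordS i, j) &
      forall i j, check_pos true (i, j) ->
        Y (i, j) * hX (i, j) (i, ordS j) =
        Y (i, ordS (ordS j)) * hX (i, ordS (ordS j)) (i, ordS j)].
Proof.
have V_neq0 a b : V a b != 0 by rewrite mulf_neq0 ?invr_eq0.
have H_neq0 a b : H a b != 0 by rewrite mulf_neq0 ?invr_eq0.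
(* Halving the second coordinate of [c a b] gives [b + 1] modulo [n]; adding [n.-1] restores [b] up
   to the period. *)
pose Y (p : pos) := y p.1./2 (p.2./2 + n.-1).
have half_mod k r : (r < 2)%N -> ((k.*2 + r) %% (2 * n))./2 = (k %% n)%N.
  move=> r2; have kn : (k %% n < n)%N by rewrite ltn_mod; lia.
  have -> : (k.*2 + r = k %/ n * (2 * n) + ((k %% n).*2 + r))%N.
    by rewrite {1}(divn_eq k n); move: (k %/ n)%N (k %% n)%N => q t; lia.
  by rewrite modnMDl modn_small; lia.
have Yc a b : Y (c a b) = y a b.
  have -> : Y (c a b) = y (o a.*2.+1)./2 ((o b.*2.+2)./2 + n.-1) by [].
  rewrite !val_o -[a.*2.+1]addn1 -[b.*2.+2]addn0 half_mod //.
  rewrite (half_mod b.+1 0%N) //.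
  rewrite (@periodic_modn _ n (fun k => y k _)); last first.
    by move=> k; apply: grid_potential_perl.
  rewrite (@periodic_modn _ n (fun k => y a (k + n.-1)%N)); last first.
    by move=> k; rewrite addnAC; apply: grid_potential_perr.
  rewrite addSnnS prednK; last exact: ltnW.
  exact: grid_potential_perr.
have cP i j : check_pos true (i, j) -> exists a b, (i, j) = c a b.
  move=> /andP[/= /eqP oi /eqP oj]; exists i./2, (j./2 + n.-1)%N; rewrite /c.
  have -> : i./2.*2.+1 = i by lia.
  have -> : (j./2 + n.-1).*2.+2 = (j + n.*2)%N by lia.
  by rewrite o_per !o_val.
exists Y; split=> [[i j] /cP[a [b ->]]|i j /cP[a [b [-> ->]]]|i j /cP[a [b [-> ->]]]].
- by rewrite Yc grid_potential_neq0.
- rewrite -!oS -/(c a b) -/(c a.+1 b) !Yc /y grid_potential_stepl //.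
  by rewrite -mulrA /V divfK.
rewrite -!oS -/(c a b) -/(c a b.+1) !Yc /y grid_potential_stepr //.
by rewrite -mulrA /H divfK.
Qed.

Lemma X_weights : exists (Y w : pos -> F),
  (forall p, check_pos true p -> Y p != 0) /\
  (forall p v, check_pos true p -> grid_adj p v -> Y p * hX p v = w v).
Proof.
have [Y [Y0 Yv Yh]] := X_potential; exists Y.
(* The X-checks at [v] lie in the second direction if [v.1] is odd and in the first otherwise; the
   successor is chosen, and [X_potential] gives the same value at the other check. *)
exists (fun v : pos => if odd v.1 then Y (v.1, ordS v.2) * hX (v.1, ordS v.2) v
  else Y (ordS v.1, v.2) * hX (ordS v.1, v.2) v); split=> // -[i j] [k l] cij.
have /andP[/= /eqP oi /eqP oj] := cij.
rewrite grid_adjE => /orP[] /andP[/= /eqP-> /[dup] /near_odd ok].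
  rewrite ok oi /=.
  by case/orP=> /eqP e; [rewrite e Yv | rewrite e].
rewrite oi /=.
by case/orP=> /eqP e; [rewrite e Yh | rewrite e].
Qed.

(** A corner relation compares a neighbour of [d] in one direction with one in the other, so two
    neighbours in the same direction are compared through a third. Thus [K d] may be read off at any
    one neighbour. *)
Lemma Z_weights (Y w : pos -> F) :
    (forall p, check_pos true p -> Y p != 0) ->
    (forall p v, check_pos true p -> grid_adj p v -> Y p * hX p v = w v) ->
  exists K : pos -> F, forall d v, check_pos false d -> grid_adj d v ->
    K d != 0 /\ K d * hZ d v = (w v)^-1.
Proof.
move=> Y0 Yw; exists (fun d : pos => (w (ordS d.1, d.2) * hZ d (ordS d.1, d.2))^-1).
have corner i i' j j' : near i i' -> near j j' -> check_pos false (i, j) ->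
    [/\ w (i', j) != 0, w (i', j) * hZ (i, j) (i', j) = w (i, j') * hZ (i, j) (i, j') &
      w (i, j') != 0].
  move=> ii jj cij; have cij' : check_pos true (i', j').
    by rewrite -(check_corner false ii jj).
  have i'i : near i' i by rewrite nearC.
  have j'j : near j' j by rewrite nearC.
  have w1 := Yw _ _ cij' (adj_horiz i' j'j).
  have w2 := Yw _ _ cij' (adj_vert j' i'i).
  rewrite -w1 -w2 !mulf_neq0 ?Y0 ?hX_neq0 ?cij' ?adj_horiz ?adj_vert //.
  by split=> //; rewrite -!mulrA (corner_relation i'i j'j cij').
move=> [i j] v cij; rewrite grid_adjE => av.
have [w1 e1 w2] := corner _ _ _ _ (nearS i) (nearS j) cij.
have z1 : hZ (i, j) (ordS i, j) != 0 by rewrite hZ_neq0 cij adj_vert ?nearS.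
split; first by rewrite invr_eq0 mulf_neq0.
have [zv wv ->] : [/\ hZ (i, j) v != 0, w v != 0 &
    w (ordS i, j) * hZ (i, j) (ordS i, j) = w v * hZ (i, j) v].
  rewrite hZ_neq0 cij grid_adjE av; case: v av => k l /=.
  case/orP=> /andP[/eqP-> kl]; last first.
    by have [] := corner _ _ _ _ (nearS i) kl cij.
  by have [? ? ?] := corner _ _ _ _ kl (nearS j) cij; split; rewrite // e1.
by rewrite invfM divfK.
Qed.

End ToricPair.

(** * Node counts, closed lines and the dimension *)

Definition X_pos n (x : 'I_(2 * n) * 'I_(2 * n)) := odd x.1 && ~~ odd x.2.
Definition Z_pos n (x : 'I_(2 * n) * 'I_(2 * n)) := ~~ odd x.1 && odd x.2.

Lemma X_posE n : @X_pos n =1 check_pos true.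
Proof. by case=> i j; rewrite /X_pos check_posE; case: (odd i); case: (odd j). Qed.

Lemma Z_posE n : @Z_pos n =1 check_pos false.
Proof. by case=> i j; rewrite /Z_pos check_posE; case: (odd i); case: (odd j). Qed.

(** Shifting the first coordinate by one carries the checks of both types bijectively onto the
    variables. *)
Lemma card_var n : #|{: Vt n}| = (#|{: CXt n}| + #|{: CZt n}|)%N.
Proof.
rewrite !card_sig.
pose sh (x : 'I_(2 * n) * 'I_(2 * n)) := (ordS x.1, x.2).
have sh_inj : injective sh.
  by move=> [i j] [k l] [] /= e ->; congr (_, _); apply/ordS_inj/val_inj.
rewrite -!sum1_card (reindex_inj sh_inj) (bigID (@X_pos n)) /=.
congr (_ + _)%N; apply: eq_bigl => -[i j];
  rewrite !unfold_in /X_pos /sh oddD odd_ordS /=;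
  by case: (odd i); case: (odd j).
Qed.

Lemma line_product_one (F : fieldType) n (HX : 'M[F]_(#|{: CXt n}|, #|{: Vt n}|))
    (hX := label (P := @X_pos n) HX) (L : nat -> 'I_(2 * n) * 'I_(2 * n)) :
    (2 <= n)%N -> cycles_product_one HX ->
    (forall k, L (k + n.*2)%N = L k) ->
    {in gtn n.*2 &, injective L} ->
    (forall k, check_pos true (L k.*2.+1)) ->
    (forall k, grid_adj (L k.*2.+1) (L k.*2) && grid_adj (L k.*2.+1) (L k.*2.+2)) ->
  \prod_(t < n) (hX (L t.*2.+1) (L t.*2.+2) / hX (L t.*2.+3) (L t.*2.+2)) = 1.
Proof.
move=> n_gt1 cyc Lper Linj Lcheck Ladj.
have PL k : X_pos (L k.*2.+1) by rewrite X_posE.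
have VL k : var_pos (L k.*2) by have /andP[a _] := Ladj k; apply: check_adj_var a.
pose vs (t : 'I_n) : Vt n := Sub (L t.*2) (VL t).
pose cs (t : 'I_n) : CXt n := Sub (L t.*2.+1) (PL t).
have Lmod k : L (k %% n).*2 = L k.*2.
  by rewrite (@periodic_modn _ n (fun k => L k.*2)) // => i; rewrite doubleD Lper.
have vsS (t : 'I_n) : val (vs (ordS t)) = L t.*2.+2.
  exact: Lmod t.+1.
have vs_inj : injective vs.
  move=> t u /(congr1 val) /= /Linj E; apply: val_inj => /=.
  by apply: double_inj; apply: E; rewrite inE ltn_double.
have cs_inj : injective cs.
  move=> t u /(congr1 val) /= /Linj E; apply: val_inj => /=.
  by apply: double_inj; apply: succn_inj; apply: E; rewrite inE ltn_Sdouble.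
have cs_adj (t : 'I_n) : grid_adj (val (cs t)) (val (vs t))
    && grid_adj (val (cs t)) (val (vs (ordS t))).
  by rewrite vsS; apply: Ladj.
have := cyc n vs cs n_gt1 vs_inj cs_inj cs_adj.
have entryE c v : entry HX c v = hX (val c) (val v) by rewrite /hX (@labelE _ _ (@X_pos n)).
under eq_bigr do rewrite !entryE vsS /=.
rewrite !prodf_div => cyc1; rewrite -[RHS]cyc1; congr (_ / _).
(* The cycle product groups factors by check; shifting the denominators one place around the closed
   line groups them by variable. *)
apply: (@prod_shift _ n (fun t => hX (L t.*2.+1) (L t.*2))).
by have := Lper 0%N; have := Lper 1%N; rewrite add0n add1n => -> ->.
Qed.

Theorem theorem1 (n m : nat) (F : finFieldType) (b : 'I_m -> F)
    (HXq : 'M[F]_(#|{: CXt n}|, #|{: Vt n}|)) (HZq : 'M[F]_(#|{: CZt n}|, #|{: Vt n}|)) :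
  (2 <= n)%N -> (1 <= m)%N -> #|F| = (2 ^ m)%N ->
  is_F2_basis b ->
  is_labeling (fun c : CXt n => val c) HXq ->
  is_labeling (fun c : CZt n => val c) HZq ->
  cycles_product_one HXq ->
  (code_dual (code_ker HZq) <= code_ker HXq)%MS ->
  let HXhat := blowup (mulmatF2 b) HXq in
  let HZhat := blowup (fun h => (mulmatF2 b h)^T) HZq in
  ((\rank (code_ker HXhat))%:Z - (\rank (code_dual (code_ker HZhat)))%:Z = (2 * m)%:Z)%R.
Proof.
move=> n_gt1 m_gt0 cardF basis_b labX labZ cyc orth HXhat HZhat.
have pchar2 : 2%N \in [pchar F] by apply: card_finPcharP cardF _.
pose hX := label (P := @X_pos n) HXq; pose hZ := label (P := @Z_pos n) HZq.
have hX_neq0 : forall c v, (hX c v != 0) = check_pos true c && grid_adj c v.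
  exact: (@label_neq0 F n true (@X_pos n) (@X_posE n) HXq labX).
have hZ_neq0 : forall c v, (hZ c v != 0) = check_pos false c && grid_adj c v.
  exact: (@label_neq0 F n false (@Z_pos n) (@Z_posE n) HZq labZ).
have orthXZ c d : check_pos true c -> check_pos false d -> \sum_v hX c v * hZ d v = 0.
  rewrite -X_posE -Z_posE => Pc Pd.
  pose k := enum_rank (Sub c Pc : CXt n); pose l := enum_rank (Sub d Pd : CZt n).
  (* The double dual of the row space of [HZq] is that space itself, so the assumed inclusion says
     that the rows of both matrices are orthogonal. *)
  have : HZq *m HXq^T = 0 by apply/sub_kermxP; rewrite -(code_dual_ker HZq).
  move/matrixP/(_ l k); rewrite !mxE => E; rewrite -[RHS]E.
  under [RHS]eq_bigr do rewrite mxE (@label_enum _ _ (@X_pos n) HXq k) mulrC enum_rankK.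
  by rewrite (@sum_cols _ _ (@Z_pos n) HZq (hX c) l) enum_rankK.
have line L := @line_product_one F n HXq L n_gt1 cyc.
have [Y [w [Y0 Yw]]] := X_weights n_gt1 pchar2 hX_neq0 hZ_neq0 orthXZ line.
have [K Kw] := Z_weights pchar2 hX_neq0 hZ_neq0 orthXZ Y0 Yw.
have lt1 : (1 < 2 * n)%N by lia.
pose i0 : 'I_(2 * n) := Ordinal (ltnW lt1); pose i1 : 'I_(2 * n) := Ordinal lt1.
have rX : \rank HXq = #|{: CXt n}|.-1.
  apply: (rank_label n_gt1 (@X_posE n) labX (Y := Y) (c0 := (i1, i0))) => //.
    exact: Y0.
  by move=> v; apply: (label_balanced n_gt1 hX_neq0 pchar2) => c; apply: Yw.
have rZ : \rank HZq = #|{: CZt n}|.-1.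
  apply: (rank_label n_gt1 (@Z_posE n) labZ (Y := K) (c0 := (i0, i1))) => //.
    by have [] := Kw (i0, i1) (ordS i0, i1) isT (adj_vert _ (nearS _)).
  move=> v; apply: (label_balanced n_gt1 hZ_neq0 pchar2 (w := fun v => (w v)^-1)).
  by move=> c cc av; have [] := Kw c v cc av.
have cardX : (0 < #|{: CXt n}|)%N by apply/card_gt0P; exists (Sub (i1, i0) isT : CXt n).
have cardZ : (0 < #|{: CZt n}|)%N by apply/card_gt0P; exists (Sub (i0, i1) isT : CZt n).
rewrite rank_code_ker code_dual_ker rank_blowup_mulmatF2 // rank_blowup_tr_mulmatF2 //.
rewrite rX rZ sum_nat_const card_ord.
rewrite card_var.
move: #|{: CXt n}| #|{: CZt n}| cardX cardZ => p q p0 q0.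
(* Of [(p + q) * m] binary coordinates, the ranks remove [p.-1 * m] and [q.-1 * m]; the two missing
   rows leave [2 * m]. *)
have -> : ((p + q) * m = p.-1 * m + q.-1 * m + 2 * m)%N by nia.
by rewrite -addnA addKn PoszD addrAC subrr add0r.
Qed.
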